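(* Assume the setting in the context. There are universal constants $C_1,C_2>0$ (independent of $B,R,d,n,\delta$) such that for every $\delta\in(0,1)$, with probability at least $1-\delta$ over the sample, every $w\in\mathbb R^d$ with $\|w\|_2\le R$ and $\nabla\widehat L(w)=0$ satisfies $$\|w-w_\star\|_2\le \frac{C_1B}{\gamma^2\lambda}\sqrt{\frac{d\,(C_2+\log(nBR))+\log(1/\delta)}{n}}.$$
   Context: Generalized linear model: pairs $(x,y)$ are drawn from a distribution $D$ on $\mathbb R^d\times\mathbb R$ where $x\sim D_x$ and $y=\sigma(w_\star^\top x)+\epsilon$, with $\epsilon$ a mean-zero noise independent of $x$, $\sigma:\mathbb R\to\mathbb R$ a known function and $w_\star\in\mathbb R^d$ unknown. Assumptions: (1) $D_x$ is supported in $\{x:\|x\|_2\le B\}$ and $\mathbb E[xx^\top]\succeq \lambda I$ for some $\lambda>0$; (2) $\|w_\star\|_2\le R$ and $BR\ge1$; (3) $\sigma$ is strictly increasing, twice differentiable, $\sigma(t)\in[0,1]$, $\sup_t\max(|\sigma'(t)|,|\sigma''(t)|)\le1$, and $\inf_{t\in[-BR,BR]}\sigma'(t)\ge\gamma>0$; (4) $|\epsilon|\le1$ almost surely. Given i.i.d. samples $(x_i,y_i)_{i=1}^n\sim D$, the empirical risk is $\widehat L(w)=\frac1{2n}\sum_{i=1}^n(y_i-\sigma(w^\top x_i))^2$. *)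

(* Defs.v *)
From HB Require Import structures.
From mathcomp Require Import all_boot all_order all_algebra.
From mathcomp Require Import all_classical all_reals all_analysis.

Set Implicit Arguments.
Unset Strict Implicit.
Unset Printing Implicit Defensive.

Import Order.TTheory GRing.Theory Num.Theory.
Import numFieldNormedType.Exports.

Local Open Scope classical_set_scope.
Local Open Scope ring_scope.

Section GLMDefs.
Variable R : realType.

(* A point of R^d given as a d-tuple (the measurable representation),
   turned into a row vector. *)
Definition rv_of_tuple (d : nat) (x : d.-tuple R) : 'rV[R]_d :=
  \row_(j < d) tnth x j.

Definition dotv (d : nat) (u v : 'rV[R]_d) : R := (u *m v^T) 0 0.
Definition norm2 (d : nat) (u : 'rV[R]_d) : R := Num.sqrt (dotv u u).

Definition emp_risk (d n : nat) (sigma : R -> R) (xs : 'I_n -> 'rV[R]_d)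
  (ys : 'I_n -> R) (w : 'rV[R]_d) : R :=
  (2 * n%:R)^-1 * \sum_(i < n) (ys i - sigma (dotv w (xs i))) ^+ 2.

Definition grad_zero (d : nat) (f : 'rV[R]_d -> R) (w : 'rV[R]_d) : Prop :=
  forall v : 'rV[R]_d, 'D_v f w = 0.

Definition second_moment (dT : measure_display) (T : measurableType dT)
  (P : probability T R) (d : nat) (X : T -> d.-tuple R) : 'M[R]_d :=
  \matrix_(j < d, k < d) fine ('E_P[fun t => tnth (X t) j * tnth (X t) k]).

Definition psd_lower_bound (d : nat) (A : 'M[R]_d) (lam : R) : Prop :=
  forall v : 'rV[R]_d, lam * dotv v v <= (v *m A *m v^T) 0 0.

End GLMDefs.

(* Main.v *)
Require Import Defs.
From HB Require Import structures.
From mathcomp Require Import all_boot all_order all_algebra.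
From mathcomp Require Import all_classical all_reals all_analysis.
From mathcomp Require Import measurable_realfun ring lra.

Import Order.TTheory GRing.Theory Num.Theory.
Import numFieldNormedType.Exports.

Local Open Scope classical_set_scope.
Local Open Scope ring_scope.

(** Let Z_w = (sigma (w.x) - sigma (w*.x) - eps) sigma' (w.x) ((w - w* ).x), so
    that a critical point w makes the empirical mean of Z_w vanish.  Since
    sigma is increasing with slope at least gamma on [-BR, BR] and the noise is
    centred and independent of x, E Z_w >= gamma^2 lambda |w - w*|^2, while
    |Z_w| <= 2 B |w - w*|: the scale of Z_w is itself proportional to the error,
    so no normalisation of directions is needed.  A one-sided Hoeffding bound for
    Z_w / (2 B |w - w*|) and a union bound over a grid of (4 n^2 + 1)^d points w0
    give, for the grid point w0 next to w and u = |w0 - w*|,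
    gamma^2 lambda u^2 <= 8 B u sqrt Q + (discretisation error), where Q is the
    quantity under the square root.

    Two a priori inequalities make this suffice.  As sigma takes values in
    [0, 1], 2 gamma B R <= 1, and lambda <= B^2; hence B / (gamma^2 lambda) >=
    4 B R^2.  So the bound is trivial when Q > 1, and otherwise d <= n, which lets
    a coordinate grid (losing a factor sqrt d) replace an optimal net. *)

(** * Euclidean geometry and calculus *)

Section Dot.
Context {R : realType} {d : nat}.
Implicit Types u v w : 'rV[R]_d.

Lemma dotvE u v : dotv u v = \sum_(j < d) u 0 j * v 0 j.
Proof. by rewrite /dotv mxE; apply: eq_bigr => j _; rewrite mxE. Qed.

Lemma dotvC u v : dotv u v = dotv v u.
Proof. by rewrite !dotvE; apply: eq_bigr => j _; rewrite mulrC. Qed.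

Lemma dotvDl u v w : dotv (u + v) w = dotv u w + dotv v w.
Proof. by rewrite /dotv mulmxDl mxE. Qed.

Lemma dotvZl a u v : dotv (a *: u) v = a * dotv u v.
Proof. by rewrite /dotv -scalemxAl mxE. Qed.

Lemma dotvNl u v : dotv (- u) v = - dotv u v.
Proof. by rewrite -scaleN1r dotvZl mulN1r. Qed.

Lemma dotvBl u v w : dotv (u - v) w = dotv u w - dotv v w.
Proof. by rewrite dotvDl dotvNl. Qed.

Lemma dotvv_ge0 u : 0 <= dotv u u.
Proof. by rewrite dotvE sumr_ge0// => j _; rewrite -expr2 sqr_ge0. Qed.

Lemma norm2_ge0 u : 0 <= norm2 u.
Proof. exact: sqrtr_ge0. Qed.

Lemma norm2_sqr u : norm2 u ^+ 2 = dotv u u.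
Proof. by rewrite sqr_sqrtr// dotvv_ge0. Qed.

Lemma norm2N u : norm2 (- u) = norm2 u.
Proof. by rewrite /norm2 dotvNl dotvC dotvNl opprK. Qed.

Lemma norm2_coord u j : `|u 0 j| <= norm2 u.
Proof.
rewrite -sqrtr_sqr ler_sqrt ?dotvv_ge0// dotvE (bigD1 j)//= -expr2 lerDl.
by rewrite sumr_ge0// => k _; rewrite -expr2 sqr_ge0.
Qed.

Lemma norm2_eq0 u : norm2 u = 0 -> u = 0.
Proof.
move=> u0; apply/rowP => j; rewrite mxE; apply/eqP; rewrite -normr_le0.
by rewrite (le_trans (norm2_coord u j))// u0.
Qed.

Lemma norm20 : norm2 (0 : 'rV[R]_d) = 0.
Proof. by rewrite /norm2 dotvE big1 ?sqrtr0// => j _; rewrite mxE mul0r. Qed.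

(** Cauchy-Schwarz: the squared length of [norm2 v *: u - norm2 u *: v] is twice [norm2 u * norm2 v
    * (norm2 u * norm2 v - dotv u v)]; when both norms are nonzero, divide by them. *)
Lemma dotv_le u v : dotv u v <= norm2 u * norm2 v.
Proof.
have [u0|u0] := eqVneq (norm2 u) 0.
  by rewrite (norm2_eq0 u u0) -(scale0r v) dotvZl mul0r mulr_ge0 ?norm2_ge0.
have [v0|v0] := eqVneq (norm2 v) 0.
  by rewrite (norm2_eq0 v v0) dotvC -(scale0r u) dotvZl mul0r mulr_ge0 ?norm2_ge0.
have up : 0 < norm2 u by rewrite lt_neqAle eq_sym u0 norm2_ge0.
have vp : 0 < norm2 v by rewrite lt_neqAle eq_sym v0 norm2_ge0.
have := dotvv_ge0 (norm2 v *: u - norm2 u *: v).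
rewrite dotvBl !dotvZl dotvC [X in _ - _ * X]dotvC !dotvBl !dotvZl.
rewrite -!norm2_sqr (dotvC v u) => h.
have : 0 <= (2 * norm2 u * norm2 v) * (norm2 u * norm2 v - dotv u v) by lra.
by rewrite pmulr_rge0 ?subr_ge0// !mulr_gt0.
Qed.

Lemma normr_dotv_le u v : `|dotv u v| <= norm2 u * norm2 v.
Proof.
by rewrite ler_norml dotv_le andbT lerNl -dotvNl -(norm2N u) dotv_le.
Qed.

Lemma norm2D u v : norm2 (u + v) <= norm2 u + norm2 v.
Proof.
rewrite -(ler_pXn2r (n:=2)) ?nnegrE ?addr_ge0 ?norm2_ge0//.
rewrite norm2_sqr dotvDl dotvC (dotvC v) !dotvDl -!norm2_sqr (dotvC v u).
by have := dotv_le u v; lra.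
Qed.

Lemma norm2_le_coord u v :
  (forall j, `|u 0 j| <= `|v 0 j|) -> norm2 u <= norm2 v.
Proof.
move=> uv; rewrite ler_sqrt ?dotvv_ge0// !dotvE ler_sum// => j _.
by rewrite -!expr2 -(real_normK (num_real (u 0 j))) -(real_normK (num_real (v 0 j)))
   ler_pXn2r ?nnegrE ?normr_ge0.
Qed.

Lemma norm2_le_const u c : 0 <= c -> (forall j, `|u 0 j| <= c) ->
  norm2 u <= Num.sqrt d%:R * c.
Proof.
move=> c0 uc; rewrite -(ler_pXn2r (n:=2)) ?nnegrE ?mulr_ge0 ?sqrtr_ge0 ?norm2_ge0//.
rewrite norm2_sqr exprMn sqr_sqrtr// dotvE mulr_natl -[X in _ *+ X]card_ord -sumr_const.
apply: ler_sum => j _.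
by rewrite -expr2 -(real_normK (num_real (u 0 j))) ler_pXn2r ?nnegrE ?normr_ge0.
Qed.

End Dot.

(* Rounding every coordinate towards 0 to the grid does not increase the norm,
   so the net stays inside the ball. *)
Definition grid_point {R : realType} {d M : nat} (s : R)
    (k : {ffun 'I_d -> 'I_(2 * M).+1}) : 'rV[R]_d :=
  \row_j (s * ((k j)%:R - M%:R)).

(** Truncate [|a| / s] to an integer [q], at most [M], and restore the sign of [a]: the index is
    [M + q] when [a] is nonnegative and [M - q] otherwise. *)
Lemma grid_round {R : realType} (M : nat) (s a : R) : 0 < s ->
  `|a| <= s * M%:R ->
  exists k : 'I_(2 * M).+1,
    `|s * (k%:R - M%:R)| <= `|a| /\ `|a - s * (k%:R - M%:R)| <= s.
Proof.
move=> s0 aM.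
pose q := Num.truncn (`|a| / s).
have as0 : 0 <= `|a| / s by rewrite divr_ge0// ltW.
have [q1 q2] : q%:R * s <= `|a| /\ `|a| < q.+1%:R * s.
  have /andP[h1 h2] := truncn_itv as0.
  by rewrite -ler_pdivlMr// -ltr_pdivrMr.
have qM : (q <= M)%N.
  rewrite -(ler_nat R) -(ler_pM2r s0) (le_trans q1)// mulrC//.
rewrite -natr1 in q2.
have [a0|a0] := leP 0 a.
  have kM : (M + q < (2 * M).+1)%N by rewrite ltnS mul2n -addnn leq_add2l.
  exists (Ordinal kM) => /=; rewrite natrD addrAC subrr add0r.
  have sq0 : 0 <= s * q%:R by rewrite mulr_ge0// ltW.
  move: q1 q2; rewrite (ger0_norm sq0) (ger0_norm a0) => q1 q2.
  by split; [rewrite mulrC|rewrite ler_norml; lra].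
have kM : (M - q < (2 * M).+1)%N.
  by rewrite ltnS mul2n -addnn (leq_trans (leq_subr _ _))// leq_addr.
exists (Ordinal kM) => /=; rewrite natrB// addrAC subrr add0r mulrN normrN.
have sq0 : 0 <= s * q%:R by rewrite mulr_ge0// ltW.
move: q1 q2; rewrite (ger0_norm sq0) (ltr0_norm a0) => q1 q2.
by split; [rewrite mulrC|rewrite ler_norml; lra].
Qed.

Lemma grid_net {R : realType} (d M : nat) (s r : R) (w : 'rV[R]_d) : 0 < s ->
  r <= s * M%:R -> norm2 w <= r ->
  exists k : {ffun 'I_d -> 'I_(2 * M).+1},
    norm2 (grid_point s k) <= norm2 w /\
    norm2 (w - grid_point s k) <= Num.sqrt d%:R * s.
Proof.
move=> s0 rM wr.
have H j := grid_round M s (w 0 j) s0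
  (le_trans (norm2_coord w j) (le_trans wr rM)).
exists [ffun j => sval (cid (H j))]; split.
  by apply: norm2_le_coord => j; rewrite mxE ffunE; case: cid => k [].
apply: norm2_le_const => [|j]; first exact: ltW.
by rewrite !mxE ffunE; case: cid => k [].
Qed.

Lemma expR_le_quadratic {R : realType} (x : R) : `|x| <= 1 ->
  expR x <= 1 + x + 2 * x ^+ 2.
Proof.
rewrite ler_norml => /andP[xN1 x1].
(* expR x = (expR (- x / 2)) ^- 2 <= (1 - x / 2) ^- 2 *)
have h : 1 - x / 2 <= expR (- x / 2) by have := expR_ge1Dx (- x / 2); lra.
have h2 : (1 - x / 2) ^+ 2 <= expR (- x).
  have -> : expR (- x) = expR (- x / 2) ^+ 2.
    by rewrite -expRM_natl; congr expR; field.
  by rewrite ler_pXn2r// nnegrE ?expR_ge0//; lra.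
have -> : expR x = (expR (- x))^-1 by rewrite expRN invrK.
rewrite -[leLHS]mul1r ler_pdivrMr ?expR_gt0//.
have q0 : 0 <= 1 + x + 2 * x ^+ 2 by nra.
apply: (le_trans _ (ler_wpM2l q0 h2)).
have -> : (1 + x + 2 * x ^+ 2) * (1 - x / 2) ^+ 2 =
  1 + x ^+ 2 * ((5 - 2 * x) * (1 - x)) / 4 by field.
by rewrite lerDl divr_ge0// mulr_ge0 ?sqr_ge0// mulr_ge0; lra.
Qed.

Section MeanValue.
Context {R : realType} (f : R -> R) (df : forall t : R, derivable f t 1).

Let fis (t : R) : is_derive t 1 f (derive1 f t).
Proof. by rewrite derive1E; apply/derivableP/df. Qed.

Let fcont : continuous f.
Proof. by move=> t; apply/differentiable_continuous/derivable1_diffP/df. Qed.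

(** The endpoints may come in either order or coincide, so the two consequences below need no case
    distinction. *)
Lemma mean_value (a b : R) : exists c,
  [/\ f b - f a = derive1 f c * (b - a), Num.min a b <= c & c <= Num.max a b].
Proof.
have [ab|ba|->] := ltgtP a b.
- have [c] := MVT ab (fun x _ => fis x) (continuous_subspaceT fcont).
  by rewrite in_itv/= => /andP[ac cb] ->; exists c; split; rewrite ?ltW.
- have [c] := MVT ba (fun x _ => fis x) (continuous_subspaceT fcont).
  rewrite in_itv/= => /andP[ac cb] h; exists c; split; rewrite ?ltW//.
  by rewrite -opprB h -mulrN opprB.
- by exists b; rewrite !subrr mulr0 lexx.
Qed.

Lemma derive1_lipschitz (M a b : R) : (forall t, `|derive1 f t| <= M) ->
  `|f b - f a| <= M * `|b - a|.
Proof.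
move=> fM; have [c [-> _ _]] := mean_value a b.
by rewrite normrM ler_wpM2r.
Qed.

(** The intermediate point stays in [[-r, r]], where the slope is at least [g]. Multiplying by
    [b - a] makes the estimate insensitive to the order of [a] and [b]. *)
Lemma derive1_ge_monotone (g r a b : R) :
  (forall t, - r <= t <= r -> g <= derive1 f t) ->
  `|a| <= r -> `|b| <= r -> g * (b - a) ^+ 2 <= (f b - f a) * (b - a).
Proof.
rewrite !ler_norml => fg /andP[a1 a2] /andP[b1 b2].
have [c [-> c1 c2]] := mean_value a b.
rewrite -mulrA -expr2 ler_wpM2r ?sqr_ge0// fg//.
rewrite (le_trans _ c1) ?le_min ?a1//=.
by rewrite (le_trans c2)// ge_max a2.
Qed.

Lemma derivable_measurable : measurable_fun setT f.
Proof. exact: continuous_measurable_fun. Qed.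

End MeanValue.

(** Along the line [h *: v + w] the risk is a function [G] of one real variable, so the directional
    derivative is the derivative of [G] at 0 and the ordinary chain rule applies. *)
Lemma derive_emp_risk {R : realType} (d n : nat) (sigma : R -> R)
    (xs : 'I_n -> 'rV[R]_d) (ys : 'I_n -> R) (w v : 'rV[R]_d) :
  (forall t, derivable sigma t 1) ->
  'D_v (emp_risk sigma xs ys) w =
  (2 * n%:R)^-1 * \sum_(i < n) - (2 * ((ys i - sigma (dotv w (xs i))) *
     (derive1 sigma (dotv w (xs i)) * dotv v (xs i)))).
Proof.
move=> ds.
pose g i (h : R) := ys i - sigma (h * dotv v (xs i) + dotv w (xs i)).
pose G (h : R) := (2 * n%:R)^-1 * \sum_(i < n) g i h ^+ 2.
have -> : 'D_v (emp_risk sigma xs ys) w = 'D_1 G (0 : R).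
  have E h : emp_risk sigma xs ys (h *: v + w) = G (h *: 1 + 0).
    rewrite /emp_risk /G; congr (_ * _); apply: eq_bigr => i _; congr (_ ^+ 2).
    by rewrite /g dotvDl dotvZl addr0 /GRing.scale/= mulr1.
  have E0 : emp_risk sigma xs ys w = G 0.
    by rewrite -[w]add0r -[X in X + w](scale0r v) E scale0r addr0.
  rewrite /derive E0.
  by under eq_fun => h do rewrite /= E.
have dg i : is_derive (0 : R) 1 (g i)
    (- (derive1 sigma (dotv w (xs i)) * dotv v (xs i))).
  have d1 : is_derive (0 : R) 1
     (fun h : R => h * dotv v (xs i) + dotv w (xs i)) (dotv v (xs i)).
  have d0 := is_deriveD (is_deriveM (is_derive_id (0 : R) (1 : R))
      (is_derive_cst (dotv v (xs i)) (0 : R) (1 : R)))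
      (is_derive_cst (dotv w (xs i)) (0 : R) (1 : R)).
    by apply: (is_derive_eq d0); rewrite /GRing.scale/= mulr0 mulr1 !addr0 add0r.
  have d2 : is_derive (0 * dotv v (xs i) + dotv w (xs i)) 1 sigma
     (derive1 sigma (dotv w (xs i))).
    by rewrite mul0r add0r derive1E; apply/derivableP/ds.
  have d3 := is_derive1_comp (f := sigma)
    (g := fun h : R => h * dotv v (xs i) + dotv w (xs i)) d2 d1.
  have d4 := is_deriveB (is_derive_cst (ys i) (0:R) 1) d3.
  move: d4; rewrite sub0r; exact.
have dG : is_derive (0 : R) 1 G ((2 * n%:R)^-1 *
   \sum_(i < n) - (2 * ((ys i - sigma (dotv w (xs i))) *
     (derive1 sigma (dotv w (xs i)) * dotv v (xs i))))).
  have d5 := is_deriveZ ((2 * n%:R)^-1)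
    (is_derive_sum (fun i => is_deriveX 2 (dg i))).
  have -> : G = (2 * n%:R)^-1 \*: \sum_(i < n) g i ^+ 2.
    by apply/funext => h; rewrite /G /= fct_sumE.
  apply: (is_derive_eq d5); congr (_ * _); apply: eq_bigr => i _.
  by rewrite /GRing.scale/= expr1 /g mul0r add0r mulrN mulrA.
exact: derive_val.
Qed.

(** * Independence and concentration *)

(** A class closed under the operations used below, whose members are integrable for every
    probability; it settles the integrability side conditions. *)
Definition bounded_measurable {R : realType} {dT} {T : measurableType dT}
    (f : T -> R) : Prop :=
  measurable_fun setT f /\ exists M, forall t, `|f t| <= M.

Section BoundedExpectation.
Context {R : realType} {dT : measure_display} {T : measurableType dT}
  (P : probability T R).
Implicit Types f g : T -> R.

Local Notation bmf := (bounded_measurable (R:=R)).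
Local Notation Ex f := (Rintegral P setT f).

Lemma bounded_measurable_cst (c : R) : bmf (fun _ : T => c).
Proof. by split=> //; exists `|c|. Qed.

Lemma bounded_measurableD f g : bmf f -> bmf g -> bmf (fun t => f t + g t).
Proof.
move=> [mf [M fM]] [mg [N gN]]; split; first exact: measurable_funD.
by exists (M + N) => t; rewrite (le_trans (ler_normD _ _))// lerD.
Qed.

Lemma bounded_measurableM f g : bmf f -> bmf g -> bmf (fun t => f t * g t).
Proof.
move=> [mf [M fM]] [mg [N gN]]; split; first exact: measurable_funM.
by exists (M * N) => t; rewrite normrM ler_pM.
Qed.

Lemma bounded_measurableN f : bmf f -> bmf (fun t => - f t).
Proof.
move=> [mf [M fM]]; split; last by exists M => t; rewrite normrN.
exact: measurableT_comp.
Qed.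

Lemma bounded_measurable_indic (A : set T) : measurable A ->
  bmf (\1_A : T -> R).
Proof.
move=> mA; split; first exact: measurable_indic.
by exists 1 => t; rewrite indicE ger0_norm// lern1 leq_b1.
Qed.

Lemma bounded_measurable_sum (I : Type) (r : seq I) (p : pred I)
    (F : I -> T -> R) : (forall i, bmf (F i)) ->
  bmf (fun t => \sum_(i <- r | p i) F i t).
Proof.
move=> bF; elim: r => [|i r IH].
  by under eq_fun do rewrite big_nil; exact: bounded_measurable_cst.
under eq_fun do rewrite big_cons.
by case: (p i) => //; exact: bounded_measurableD.
Qed.

Lemma bounded_measurable_prod (I : Type) (r : seq I) (p : pred I)
    (F : I -> T -> R) : (forall i, bmf (F i)) ->
  bmf (fun t => \prod_(i <- r | p i) F i t).
Proof.
move=> bF; elim: r => [|i r IH].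
  by under eq_fun do rewrite big_nil; exact: bounded_measurable_cst.
under eq_fun do rewrite big_cons.
by case: (p i) => //; exact: bounded_measurableM.
Qed.

Lemma bounded_measurable_expR f : bmf f -> bmf (fun t => expR (f t)).
Proof.
move=> [mf [M fM]]; split; first exact: measurableT_comp.
exists (expR M) => t; rewrite ger0_norm ?expR_ge0// ler_expR.
by rewrite (le_trans (ler_norm _)).
Qed.

Lemma bounded_measurable_integrable f : bmf f ->
  P.-integrable setT (EFin \o f).
Proof.
move=> [mf [M fM]]; apply: measurable_bounded_integrable => //.
  by rewrite (le_lt_trans (probability_le1 _ _))// ltry.
exists M; split; first exact: num_real.
by move=> x Mx t _ /=; rewrite (le_trans (fM t))// ltW.
Qed.

Lemma mean_cst (c : R) : Ex (fun _ => c) = c.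
Proof. by rewrite Rintegral_cst//= probability_setT mulr1. Qed.

Lemma meanD f g : bmf f -> bmf g ->
  Ex (fun t => f t + g t) = Ex f + Ex g.
Proof. by move=> bf bg; rewrite RintegralD//; exact: bounded_measurable_integrable. Qed.

Lemma meanZ (c : R) f : bmf f -> Ex (fun t => c * f t) = c * Ex f.
Proof. by move=> bf; rewrite RintegralZl//; exact: bounded_measurable_integrable. Qed.

Lemma mean_le f g : bmf f -> bmf g -> (forall t, f t <= g t) -> Ex f <= Ex g.
Proof.
by move=> bf bg fg; apply: le_Rintegral => //; exact: bounded_measurable_integrable.
Qed.

Lemma mean_sum (I : Type) (r : seq I) (F : I -> T -> R) :
  (forall i, bmf (F i)) ->
  Ex (fun t => \sum_(i <- r) F i t) = \sum_(i <- r) Ex (F i).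
Proof.
move=> bF; elim: r => [|i r IH].
  by rewrite big_nil -[RHS]mean_cst; apply: eq_Rintegral => t _; rewrite big_nil.
rewrite big_cons -IH -meanD//; last exact: bounded_measurable_sum.
by apply: eq_Rintegral => t _; rewrite big_cons.
Qed.

Lemma mean_indic (A : set T) : measurable A -> (Ex \1_A)%:E = P A.
Proof.
move=> mA; rewrite /Rintegral integral_indic// setIT fineK//.
exact: fin_num_measure.
Qed.

Lemma mean_norm_le f (c : R) : bmf f -> (forall t, `|f t| <= c) -> `|Ex f| <= c.
Proof.
move=> bf fc.
rewrite ler_norml -[X in X <= _](mean_cst (- c)) -[X in _ && (_ <= X)](mean_cst c).
have H t : - c <= f t <= c by rewrite -ler_norml.
apply/andP; split; apply: mean_le => //; try exact: bounded_measurable_cst;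
  by move=> t; case/andP: (H t).
Qed.

End BoundedExpectation.

Section Independence.
Context {R : realType} {dT dS : measure_display} {T : measurableType dT}
  {S : measurableType dS} (P : probability T R).
Local Notation bmf := (bounded_measurable (R:=R)).
Local Notation Ex f := (Rintegral P setT f).

(** Cut the range [[-c, c]] into layers of height [e]: [A k] collects the points where [g] lies in
    the [k]-th layer and [b k] is the lower edge of that layer. The bound on [g] is asked pointwise
    because later [g] is bounded only along a random variable. *)
Lemma simple_approximation (g : S -> R) (c e : R) : measurable_fun setT g ->
  0 < e -> exists K (b : 'I_K -> R) (A : 'I_K -> set S),
    (forall k, measurable (A k)) /\
    forall y, `|g y| <= c -> `|g y - \sum_(k < K) b k * \1_(A k) y| <= e.
Proof.
move=> mg e0.
pose q y := Num.truncn ((g y + c) / e).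
exists (Num.truncn (2 * c / e)).+1, (fun k => k%:R * e - c),
  (fun k => [set y | (k%:R <= (g y + c) / e < k.+1%:R)]); split.
  move=> k.
  have -> : [set y | k%:R <= (g y + c) / e < k.+1%:R] =
     (fun y => (g y + c) / e) @^-1` `[(k%:R : R), k.+1%:R[%classic.
    by apply/seteqP; split=> y /=; rewrite in_itv.
  rewrite -[X in measurable X]setTI; apply: measurable_funM => //.
  exact: measurable_funD.
move=> y; rewrite ler_norml => /andP[gc1 gc2].
have q0 : 0 <= (g y + c) / e by rewrite divr_ge0 ?(ltW e0)//; lra.
have /andP[q1 q2] := truncn_itv q0.
have qK : (q y < (Num.truncn (2 * c / e)).+1)%N.
  by rewrite ltnS /q le_truncn// ler_pM2r ?invr_gt0//; lra.
rewrite (bigD1 (Ordinal qK))//= big1 ?addr0 => [|k kq].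
  rewrite indicE mem_set ?mulr1//=; last by rewrite /q q1.
  rewrite -/(q y) ler_pdivlMr// in q1; rewrite -/(q y) ltr_pdivrMr// -natr1 in q2.
  by rewrite ler_norml; lra.
rewrite indicE memNset ?mulr0//= => /andP[k1 k2].
move/eqP : kq; apply; apply/val_inj => /=.
by apply/esym/truncn_def; rewrite k1.
Qed.

(** Factorisation passes from indicators to simple functions by linearity, and then to [g] by
    uniform approximation. Assuming it only for the given [f] lets the lemma serve products of many
    factors as well as pairs. *)
Lemma mean_mul_factor (f : T -> R) (g : S -> R) (Y : T -> S) :
  bmf f -> measurable_fun setT g -> measurable_fun setT Y -> bmf (g \o Y) ->
  (forall A, measurable A ->
     Ex (fun t => f t * \1_A (Y t)) = Ex f * Ex (fun t => \1_A (Y t))) ->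
  Ex (fun t => f t * g (Y t)) = Ex f * Ex (fun t => g (Y t)).
Proof.
move=> bf mg mY bgY fA.
have [_ [C gC]] := bgY; have [_ [M fM]] := bf.
have M0 : 0 <= M by rewrite (le_trans _ (fM point)).
apply/eqP; rewrite -subr_eq0 -normr_le0; apply/ler_addgt0Pl => e e0; rewrite addr0.
(* The two error terms are at most [M * e'] each; [M + 1] keeps the denominator positive when [M] is
   0. *)
pose e' := e / (2 * (M + 1)).
have e'0 : 0 < e' by rewrite divr_gt0//; lra.
have [K [b [A [mA Ab]]]] := simple_approximation g C e' mg e'0.
pose h t := \sum_(k < K) b k * \1_(A k) (Y t).
have bA k : bmf (fun t => \1_(A k) (Y t) : R).
  have -> : (fun t => \1_(A k) (Y t)) = \1_(Y @^-1` A k) :> (T -> R).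
    by apply/funext => t; rewrite !indicE.
  apply: bounded_measurable_indic; rewrite -[X in measurable X]setTI.
  exact: mY.
have bAb k : bmf (fun t => b k * \1_(A k) (Y t)).
  by apply: bounded_measurableM => //; exact: bounded_measurable_cst.
have bh : bmf h by exact: bounded_measurable_sum.
have fh : Ex (fun t => f t * h t) = Ex f * Ex h.
  rewrite [X in _ * X]mean_sum// mulr_sumr.
  under eq_Rintegral do rewrite mulr_sumr.
  rewrite mean_sum; last by move=> k; exact: bounded_measurableM.
  apply: eq_bigr => k _; rewrite meanZ// [RHS]mulrCA -fA// -meanZ; last first.
    exact: bounded_measurableM.
  by apply: eq_Rintegral => t _; rewrite mulrCA.
pose r t := g (Y t) - h t.
have br : bmf r by apply: bounded_measurableD => //; exact: bounded_measurableN.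
have re t : `|r t| <= e' by apply: Ab; exact: gC.
have gE : (fun t => g (Y t)) = (fun t => h t + r t).
  by apply/funext => t; rewrite /r addrC subrK.
have -> : Ex (fun t => f t * g (Y t)) =
    Ex (fun t => f t * h t) + Ex (fun t => f t * r t).
  rewrite -meanD; try exact: bounded_measurableM.
  by apply: eq_Rintegral => t _; rewrite -mulrDr /r addrC subrK.
have -> : Ex (fun t => g (Y t)) = Ex h + Ex r by rewrite gE meanD.
have -> : Ex (fun t => f t * h t) + Ex (fun t => f t * r t)
    - Ex f * (Ex h + Ex r) = Ex (fun t => f t * r t) - Ex f * Ex r.
  by rewrite fh; ring.
have e'E : e = M * e' + M * e' + 2 * e'.
  by rewrite /e'; field; rewrite gt_eqF//; lra.
have h1 : `|Ex (fun t => f t * r t)| <= M * e'.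
  apply: mean_norm_le; first exact: bounded_measurableM.
  by move=> t; rewrite normrM ler_pM.
have h2 : `|Ex f * Ex r| <= M * e'.
  by rewrite normrM ler_pM// mean_norm_le.
rewrite (le_trans (ler_normB _ _))// (le_trans (lerD h1 h2))// e'E lerDl.
by rewrite mulr_ge0// ltW.
Qed.

Lemma mean_prod_independent (n : nat) (Z : 'I_n -> T -> S) (g : 'I_n -> S -> R) :
  (forall i, measurable_fun setT (Z i)) ->
  (forall A : 'I_n -> set S, (forall i, measurable (A i)) ->
     P (\bigcap_(i in [set: 'I_n]) (Z i @^-1` A i)) =
     (\prod_(i < n) P (Z i @^-1` A i))%E) ->
  (forall i, measurable_fun setT (g i)) -> (forall i, bmf (g i \o Z i)) ->
  Ex (fun t => \prod_(i < n) g i (Z i t)) = \prod_(i < n) Ex (fun t => g i (Z i t)).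
Proof.
move=> mZ ind mg bg.
have mpre i A : measurable A -> measurable (Z i @^-1` A).
  by move=> mA; rewrite -[X in measurable X]setTI; exact: mZ.
(* the g i are released from indicators to arbitrary functions one at a time *)
suff H k : (k <= n)%N -> forall g : 'I_n -> S -> R,
    (forall i, measurable_fun setT (g i)) -> (forall i, bmf (g i \o Z i)) ->
    (forall i : 'I_n, (k <= i)%N -> exists2 A, measurable A & g i = \1_A) ->
  Ex (fun t => \prod_(i < n) g i (Z i t)) = \prod_(i < n) Ex (fun t => g i (Z i t)).
  by apply: (H n) => // i; rewrite leqNgt ltn_ord.
(* For [k = 0] every [g i] is an indicator, so the product is the indicator of the intersection and
   the independence of events applies. *)
elim: k => [|k IH] kn {}g {}mg {}bg gA.
  have Ai (i : 'I_n) : exists2 A, measurable A & g i = \1_A by exact: gA.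
  pose A i := sval (cid2 (Ai i)).
  have mA i : measurable (A i) by rewrite /A; case: cid2.
  have gAi i : g i = \1_(A i) by rewrite /A; case: cid2.
  have L : (fun t => \prod_(i < n) g i (Z i t)) =
      \1_(\bigcap_(i in [set: 'I_n]) (Z i @^-1` A i)).
    apply/funext => t; rewrite indicE.
    have [tA|tA] := boolP (t \in _).
      rewrite big1// => i _; rewrite gAi indicE mem_set//.
      by move/set_mem : tA; exact.
    have [i Ait] : exists i, ~ A i (Z i t).
      by apply/existsNP => tAi; move/negP: tA; apply; apply/mem_set => i _; exact: tAi.
    by rewrite (bigD1 i)//= gAi indicE memNset// mul0r.
  have mI : measurable (\bigcap_(i in [set: 'I_n]) (Z i @^-1` A i)).
    by apply: fin_bigcap_measurable => // i _; exact: mpre.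
  apply: EFin_inj; rewrite L mean_indic// ind// -prodEFin.
  apply: eq_bigr => i _; rewrite -mean_indic; last exact: mpre.
  by congr EFin; apply: eq_Rintegral => t _; rewrite gAi !indicE.
pose k' := Ordinal kn.
pose f t := \prod_(i < n | i != k') g i (Z i t).
have fE : (fun t => \prod_(i < n) g i (Z i t)) = (fun t => f t * g k' (Z k' t)).
  by apply/funext => t; rewrite (bigD1 k')//= mulrC.
have bf : bmf f by exact: bounded_measurable_prod.
have fA A : measurable A -> Ex (fun t => f t * \1_A (Z k' t)) =
    \prod_(i < n | i != k') Ex (fun t => g i (Z i t)) * Ex (fun t => \1_A (Z k' t)).
  (* Putting an indicator back at index [k'] brings the family within reach of the induction
     hypothesis. *)
  move=> mA; pose g' i := if i == k' then \1_A : S -> R else g i.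
  have g'k : g' k' = \1_A by rewrite /g' eqxx.
  have g'i i : i != k' -> g' i = g i by rewrite /g' => /negbTE ->.
  have -> : (fun t => f t * \1_A (Z k' t)) = (fun t => \prod_(i < n) g' i (Z i t)).
    apply/funext => t; rewrite (bigD1 k')//= g'k mulrC; congr (_ * _).
    by apply: eq_bigr => i ik; rewrite g'i.
  rewrite IH ?(ltnW kn)// => [|i|i|i ki].
  - rewrite (bigD1 k')//= g'k mulrC; congr (_ * _).
    by apply: eq_bigr => i ik; rewrite g'i.
  - by have [->|ik] := eqVneq i k'; [rewrite g'k|rewrite g'i].
  - have [->|ik] := eqVneq i k'; last by rewrite g'i.
    rewrite g'k; exact: (bounded_measurable_indic (Z k' @^-1` A) (mpre _ _ mA)).
  - have [ik|ik] := eqVneq i k'; first by exists A => //; rewrite ik.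
    rewrite g'i//; apply: gA; rewrite ltn_neqAle ki andbT eq_sym.
    by apply: contra ik => /eqP ik; apply/eqP/val_inj.
rewrite fE [RHS](bigD1 k')//= mulrC.
(* The case [A = setT] of [fA] identifies the mean of the remaining product. *)
have fT : Ex f = \prod_(i < n | i != k') Ex (fun t => g i (Z i t)).
  transitivity (Ex (fun t => f t * \1_setT (Z k' t))).
    by apply: eq_Rintegral => t _; rewrite indicT mulr1.
  rewrite fA// [X in _ * X](_ : _ = 1) ?mulr1// -[RHS](mean_cst P).
  by apply: eq_Rintegral => t _; rewrite indicT.
by rewrite -fT; apply: mean_mul_factor => // A mA; rewrite fA// fT.
Qed.

End Independence.

(** Two uses of [mean_mul_factor], first replacing [g] by an indicator and then [f], reduce the
    claim to independence of events. *)
Lemma mean_mul_independent {R : realType} {dT dS dS' : measure_display}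
    {T : measurableType dT} {S : measurableType dS} {S' : measurableType dS'}
    (P : probability T R) (U : T -> S) (V : T -> S') (f : S -> R) (g : S' -> R) :
  measurable_fun setT U -> measurable_fun setT V ->
  (forall A B, measurable A -> measurable B ->
     P (U @^-1` A `&` V @^-1` B) = (P (U @^-1` A) * P (V @^-1` B))%E) ->
  measurable_fun setT f -> measurable_fun setT g ->
  bounded_measurable (f \o U) -> bounded_measurable (g \o V) ->
  \int[P]_t (f (U t) * g (V t)) = \int[P]_t f (U t) * \int[P]_t g (V t).
Proof.
move=> mU mV ind mf mg bf bg.
have mpre A : measurable A -> measurable (U @^-1` A).
  by move=> mA; rewrite -[X in measurable X]setTI; exact: mU.
have mpre' A : measurable A -> measurable (V @^-1` A).
  by move=> mA; rewrite -[X in measurable X]setTI; exact: mV.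
apply: mean_mul_factor => // B mB.
have bB : bounded_measurable (fun t => \1_B (V t) : R).
  exact: (bounded_measurable_indic (V @^-1` B) (mpre' _ mB)).
under eq_Rintegral do rewrite mulrC.
rewrite [RHS]mulrC; apply: mean_mul_factor => // A mA.
apply: EFin_inj; rewrite EFinM.
rewrite (mean_indic P _ (mpre' _ mB)) (mean_indic P _ (mpre _ mA)) muleC -ind//.
rewrite -mean_indic; last by apply: measurableI; [exact: mpre|exact: mpre'].
congr EFin; apply: eq_Rintegral => t _.
by rewrite mulrC -[RHS]/(\1_(_ `&` _) t) indicI.
Qed.

(* Chernoff bound at parameter s: the estimate expR x <= 1 + x + 2 x^2 costs
   2 s^2 per variable and the gap 4 s gains 4 s^2. *)
Lemma hoeffding_lower_tail {R : realType} {dT dS : measure_display}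
    {T : measurableType dT} {S : measurableType dS} (P : probability T R)
    (n : nat) (Z : 'I_n -> T -> S) (f : S -> R) (m s : R) :
  (forall i, measurable_fun setT (Z i)) ->
  (forall A : 'I_n -> set S, (forall i, measurable (A i)) ->
     P (\bigcap_(i in [set: 'I_n]) (Z i @^-1` A i)) =
     (\prod_(i < n) P (Z i @^-1` A i))%E) ->
  measurable_fun setT f -> (forall i t, `|f (Z i t)| <= 1) ->
  (forall i, m <= \int[P]_t f (Z i t)) -> 0 <= s <= 1 ->
  (P [set t | (\sum_(i < n) f (Z i t) <= n%:R * (m - 4 * s))%R] <=
    (expR (- (2 * n%:R * s ^+ 2)))%:E)%E.
Proof.
move=> mZ ind mf f1 mE /andP[s0 s1].
have bf i : bounded_measurable (fun t => f (Z i t)).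
  by split; [exact: measurableT_comp|exists 1].
pose F t := \sum_(i < n) f (Z i t).
have bF : bounded_measurable F by exact: bounded_measurable_sum.
set A := [set t | _].
have mA : measurable A.
  rewrite [A](_ : _ = setT `&` F @^-1` `]-oo, n%:R * (m - 4 * s)]%classic).
    by apply: bF.1.
  by apply/seteqP; split=> t; rewrite /A/= in_itv/=; [|case].
have bN i : bounded_measurable (fun t => - s * f (Z i t)).
  by apply: bounded_measurableM => //; exact: bounded_measurable_cst.
have be i := bounded_measurable_expR _ (bN i).
have bp : bounded_measurable (fun t => \prod_(i < n) expR (- s * f (Z i t))).
  exact: bounded_measurable_prod.
have mgf i : \int[P]_t expR (- s * f (Z i t)) <= expR (2 * s ^+ 2 - s * m).
  have bq : bounded_measurable (fun t => (1 + 2 * s ^+ 2) + - s * f (Z i t)).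
    by apply: bounded_measurableD => //; exact: bounded_measurable_cst.
  apply: (le_trans (mean_le P _ _ (be i) bq _)) => [t|].
    have sf1 : `|- s * f (Z i t)| <= 1 by rewrite normrM normrN mulr_ile1// ger0_norm.
    apply: (le_trans (expR_le_quadratic _ sf1)).
    have : f (Z i t) ^+ 2 <= 1.
      by rewrite -(real_normK (num_real _)) expr_le1.
    by move=> h; have := ler_wpM2l (sqr_ge0 s) h; lra.
  rewrite meanD//; last exact: bounded_measurable_cst.
  rewrite mean_cst meanZ// (le_trans _ (expR_ge1Dx _))//.
  by have := ler_wpM2l s0 (mE i); lra.
rewrite -mean_indic// lee_fin.
have bc : bounded_measurable (fun t => expR (s * (n%:R * (m - 4 * s))) *
    \prod_(i < n) expR (- s * f (Z i t))).
  by apply: bounded_measurableM => //; exact: bounded_measurable_cst.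
(* Exponential Markov inequality: on [A] the exponent of the dominating function is nonnegative, and
   off [A] the indicator vanishes. *)
apply: (le_trans (mean_le P _ _ (bounded_measurable_indic _ mA) bc _)) => [t|].
  rewrite -expR_sum -expRD indicE -mulr_sumr.
  have [/set_mem At|_] := boolP (t \in A); last by rewrite expR_ge0.
  have -> : true%:R = expR 0 :> R by rewrite expR0.
  by rewrite ler_expR mulNr subr_ge0 ler_wpM2l.
rewrite meanZ// (mean_prod_independent P n Z (fun _ y => expR (- s * f y)))//; last first.
  by move=> i; do 2 apply: measurableT_comp => //.
have hp : \prod_(i < n) \int[P]_t expR (- s * f (Z i t)) <=
    expR (2 * s ^+ 2 - s * m) ^+ n.
  rewrite -[X in _ <= _ ^+ X]card_ord -prodr_const; apply: ler_prod => i _.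
  by rewrite mgf andbT Rintegral_ge0// => t _; exact: expR_ge0.
apply: (le_trans (ler_wpM2l (expR_ge0 _) hp)).
rewrite -expRM_natl -expRD ler_expR le_eqVlt; apply/orP; left; apply/eqP.
by ring.
Qed.

(** * The score and its mean *)

(** Half the derivative, in the direction [w - wstar], of the squared loss of one observation; [z]
    pairs the point with its noise, the response being expressed through [wstar]. *)
Definition score {R : realType} {d : nat} (sigma : R -> R)
    (wstar w : 'rV[R]_d) (z : d.-tuple R * R) : R :=
  let x := rv_of_tuple z.1 in
  (sigma (dotv w x) - sigma (dotv wstar x) - z.2) *
  (derive1 sigma (dotv w x) * dotv (w - wstar) x).

Section Score.
Context {R : realType} {d : nat} (sigma : R -> R) (wstar : 'rV[R]_d).
Local Notation score := (score sigma wstar).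

Lemma measurable_dotv (w : 'rV[R]_d) :
  measurable_fun setT (fun x : d.-tuple R => dotv w (rv_of_tuple x)).
Proof.
under eq_fun do rewrite dotvE.
apply: measurable_sum => j; apply: measurable_funM => //.
by under eq_fun do rewrite mxE; exact: measurable_tnth.
Qed.

Lemma measurable_dotvv :
  measurable_fun setT (fun x : d.-tuple R => dotv (rv_of_tuple x) (rv_of_tuple x)).
Proof.
under eq_fun do rewrite dotvE.
by apply: measurable_sum => j; apply: measurable_funM => //;
  under eq_fun do rewrite mxE; exact: measurable_tnth.
Qed.

Lemma measurable_score (w : 'rV[R]_d) :
  (forall t : R, derivable sigma t 1) ->
  (forall t : R, derivable (derive1 sigma) t 1) ->
  measurable_fun setT (score w).
Proof.
move=> /derivable_measurable ms /derivable_measurable ms'.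
have md v : measurable_fun setT
    (fun z : d.-tuple R * R => dotv v (rv_of_tuple z.1)).
  exact: measurableT_comp (measurable_dotv v) measurable_fst.
rewrite /score; apply: measurable_funM; last first.
  by apply: measurable_funM => //; exact: (measurableT_comp ms' (md w)).
apply: measurable_funB => //; apply: measurable_funB.
  exact: (measurableT_comp ms (md w)).
exact: (measurableT_comp ms (md wstar)).
Qed.

Context (B : R) (sigma01 : forall t, 0 <= sigma t <= 1)
  (ds : forall t : R, derivable sigma t 1)
  (ds1 : forall t : R, `|derive1 sigma t| <= 1).

(** The residual is at most 2, one unit from the two values of [sigma] and one from the noise;
    Cauchy-Schwarz bounds the other factor. *)
Lemma score_bound w (z : d.-tuple R * R) :
  norm2 (rv_of_tuple z.1) <= B -> `|z.2| <= 1 ->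
  `|score w z| <= 2 * B * norm2 (w - wstar).
Proof.
move=> xB e1; rewrite /score; set x := rv_of_tuple z.1.
have h1 : `|sigma (dotv w x) - sigma (dotv wstar x) - z.2| <= 2.
  have /andP[? ?] := sigma01 (dotv w x); have /andP[? ?] := sigma01 (dotv wstar x).
  by move: e1; rewrite !ler_norml => /andP[? ?]; lra.
have h2 : `|derive1 sigma (dotv w x) * dotv (w - wstar) x| <= B * norm2 (w - wstar).
  rewrite normrM -[leRHS]mul1r ler_pM// (le_trans (normr_dotv_le _ _))//.
  by rewrite mulrC ler_wpM2r ?norm2_ge0.
by rewrite normrM -mulrA ler_pM.
Qed.

(** Change [sigma], its derivative and the linear factor one at a time. The three changes cost 2, 4
    and 2 times [B ^+ 2 * r * eta], the last one because [1 <= B * r]. *)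
Lemma score_lipschitz (r eta : R) w w0 (z : d.-tuple R * R) :
  (forall t : R, derivable (derive1 sigma) t 1) ->
  (forall t, `|derive1 (derive1 sigma) t| <= 1) ->
  1 <= B * r -> norm2 wstar <= r -> norm2 w <= r ->
  norm2 (w - w0) <= eta ->
  norm2 (rv_of_tuple z.1) <= B -> `|z.2| <= 1 ->
  `|score w z - score w0 z| <= 8 * B ^+ 2 * r * eta.
Proof.
move=> ds' ds2 Br1 wsr wr ww0 xB e1; rewrite /score; set x := rv_of_tuple z.1.
rewrite !dotvBl; set a := dotv w x; set a0 := dotv w0 x; set b := dotv wstar x.
have B0 : 0 <= B by rewrite (le_trans _ xB) ?norm2_ge0.
have r0 : 0 <= r by rewrite (le_trans _ wr) ?norm2_ge0.
have eta0 : 0 <= eta by rewrite (le_trans _ ww0) ?norm2_ge0.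
have aa0 : `|a - a0| <= B * eta.
  rewrite -dotvBl (le_trans (normr_dotv_le _ _))// mulrC.
  by rewrite ler_pM ?norm2_ge0.
have vb v : norm2 v <= r -> `|dotv v x| <= B * r.
  by move=> vr; rewrite (le_trans (normr_dotv_le _ _))// mulrC ler_pM ?norm2_ge0.
have ab : `|a - b| <= 2 * (B * r).
  by rewrite (le_trans (ler_normB _ _))// mulr2n mulrDl mul1r lerD ?vb.
have saa0 : `|sigma a - sigma a0| <= B * eta.
  by rewrite (le_trans (derive1_lipschitz sigma ds 1 _ _ ds1))// mul1r.
have s'aa0 : `|derive1 sigma a - derive1 sigma a0| <= B * eta.
  by rewrite (le_trans (derive1_lipschitz _ ds' 1 _ _ ds2))// mul1r.
have h1 : `|sigma a0 - sigma b - z.2| <= 2.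
  have /andP[? ?] := sigma01 a0; have /andP[? ?] := sigma01 b.
  by move: e1; rewrite !ler_norml => /andP[? ?]; lra.
have -> : (sigma a - sigma b - z.2) * (derive1 sigma a * (a - b)) -
    (sigma a0 - sigma b - z.2) * (derive1 sigma a0 * (a0 - b)) =
    (sigma a - sigma a0) * derive1 sigma a * (a - b) +
    ((sigma a0 - sigma b - z.2) * (derive1 sigma a - derive1 sigma a0) * (a - b) +
    (sigma a0 - sigma b - z.2) * derive1 sigma a0 * (a - a0)) by ring.
have m3 (p q s P Q S : R) : `|p| <= P -> `|q| <= Q -> `|s| <= S ->
    `|p * q * s| <= P * Q * S.
  by move=> pP qQ sS; rewrite !normrM !ler_pM ?mulr_ge0.
have k1 := m3 _ _ _ _ _ _ saa0 (ds1 a) ab.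
have k2 := m3 _ _ _ _ _ _ h1 s'aa0 ab.
have k3 := m3 _ _ _ _ _ _ h1 (ds1 a0) aa0.
rewrite (le_trans (ler_normD _ _))// (le_trans (lerD k1 (ler_normD _ _)))//.
rewrite (le_trans (lerD (lexx _) (lerD k2 k3)))//.
by have := ler_wpM2l (mulr_ge0 B0 eta0) Br1; lra.
Qed.

(** The vanishing gradient is tested in the single direction [w - wstar]; the prefactor cancels
    because [n] is positive. *)
Lemma sum_score_grad_zero (n : nat) (x : 'I_n -> d.-tuple R) (e : 'I_n -> R) w :
  (0 < n)%N ->
  grad_zero (emp_risk sigma (fun i => rv_of_tuple (x i))
    (fun i => sigma (dotv wstar (rv_of_tuple (x i))) + e i)) w ->
  \sum_(i < n) score w (x i, e i) = 0.
Proof.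
move=> n0 /(_ (w - wstar)); rewrite derive_emp_risk// => /eqP.
rewrite mulf_eq0 invr_eq0 mulf_eq0 !pnatr_eq0 -[n == 0%N]negbK -lt0n n0 /= => /eqP h.
apply: (@mulfI _ (2 : R)); rewrite ?pnatr_eq0// mulr0 -[RHS]h mulr_sumr.
by apply: eq_bigr => i _; rewrite /score/=; ring.
Qed.

End Score.

Section Population.
Context {R : realType} {dT : measure_display} {T : measurableType dT}
  (P : probability T R) {d : nat} (X : T -> d.-tuple R) (B lam : R)
  (mX : measurable_fun setT X)
  (XB : forall t, norm2 (rv_of_tuple (X t)) <= B)
  (XP : psd_lower_bound (second_moment P X) lam).

Let B0 : 0 <= B.
Proof. by rewrite (le_trans _ (XB point)) ?norm2_ge0. Qed.

Lemma bounded_measurable_tnth j : bounded_measurable (fun t => tnth (X t) j).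
Proof.
split; first exact: measurableT_comp (measurable_tnth j) mX.
exists B => t; rewrite (le_trans _ (XB t))//.
by have := norm2_coord (rv_of_tuple (X t)) j; rewrite mxE.
Qed.

Lemma bounded_measurable_dotv w :
  bounded_measurable (fun t => dotv w (rv_of_tuple (X t))).
Proof.
split; first exact: measurableT_comp (measurable_dotv w) mX.
exists (norm2 w * B) => t; rewrite (le_trans (normr_dotv_le _ _))//.
by rewrite ler_wpM2l ?norm2_ge0.
Qed.

(** Expanding the square turns the integral into the quadratic form of [second_moment]. *)
Lemma mean_dotv_sqr_ge v :
  lam * dotv v v <= \int[P]_t dotv v (rv_of_tuple (X t)) ^+ 2.
Proof.
apply: (le_trans (XP v)); rewrite le_eqVlt; apply/orP; left; apply/eqP.
pose F j k t := v 0 j * v 0 k * (tnth (X t) j * tnth (X t) k).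
have bF j k : bounded_measurable (F j k).
  apply: bounded_measurableM; first exact: bounded_measurable_cst.
  by apply: bounded_measurableM; exact: bounded_measurable_tnth.
have -> : (fun t => dotv v (rv_of_tuple (X t)) ^+ 2) =
    (fun t => \sum_(k < d) \sum_(j < d) F j k t).
  apply/funext => t; rewrite dotvE expr2 mulr_sumr; apply: eq_bigr => k _.
  by rewrite mulr_suml; apply: eq_bigr => j _; rewrite /F !mxE; ring.
rewrite mean_sum; last by move=> k; exact: bounded_measurable_sum.
rewrite mxE; apply: eq_bigr => k _; rewrite mean_sum// !mxE mulr_suml.
apply: eq_bigr => j _; rewrite !mxE meanZ; last first.
  by apply: bounded_measurableM; exact: bounded_measurable_tnth.
by rewrite unlock -/(Rintegral _ _ _) mulrAC.
Qed.

(** Test the quadratic form on the first basis vector, which exists as [d] is positive. *)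
Lemma second_moment_bound : (0 < d)%N -> lam <= B ^+ 2.
Proof.
move=> d0; pose v : 'rV[R]_d := \row_j (j == Ordinal d0)%:R.
have vv : dotv v v = 1.
  rewrite dotvE (bigD1 (Ordinal d0))//= !mxE eqxx mulr1 big1 ?addr0// => j jd.
  by rewrite !mxE (negbTE jd) mulr0.
have := mean_dotv_sqr_ge v; rewrite vv mulr1 => /le_trans; apply.
have bv := bounded_measurable_dotv v.
rewrite -[leRHS](mean_cst P); apply: mean_le.
- by under eq_fun do rewrite expr2; exact: bounded_measurableM.
- exact: bounded_measurable_cst.
- move=> t; rewrite -(real_normK (num_real _)) ler_pXn2r ?nnegrE//.
  rewrite (le_trans (normr_dotv_le _ _))// /norm2 vv sqrtr1 mul1r.
  exact: XB.
Qed.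

(** After the noise term averages out, the bound holds pointwise: one factor [gam] comes from the
    derivative at [dotv w x], the other from the strong monotonicity of [sigma] between the two
    linear predictors. *)
Lemma mean_score_ge (Eps : T -> R) (sigma : R -> R) (wstar w : 'rV[R]_d) (r gam : R) :
  measurable_fun setT Eps -> (forall t, `|Eps t| <= 1) -> \int[P]_t Eps t = 0 ->
  (forall (A : set (d.-tuple R)) (E : set R), measurable A -> measurable E ->
     P (X @^-1` A `&` Eps @^-1` E) = (P (X @^-1` A) * P (Eps @^-1` E))%E) ->
  (forall t : R, derivable sigma t 1) ->
  (forall t : R, derivable (derive1 sigma) t 1) ->
  (forall t, 0 <= sigma t <= 1) -> (forall t, `|derive1 sigma t| <= 1) ->
  0 < gam -> (forall t, - (B * r) <= t <= B * r -> gam <= derive1 sigma t) ->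
  norm2 wstar <= r -> norm2 w <= r ->
  gam ^+ 2 * lam * norm2 (w - wstar) ^+ 2 <=
    \int[P]_t score sigma wstar w (X t, Eps t).
Proof.
move=> mE E1 E0 ind ds ds' s01 ds1 g0 sg wsr wr.
have bE : bounded_measurable Eps by split => //; exists 1.
have ms := derivable_measurable sigma ds.
have ms' := derivable_measurable _ ds'.
pose g x := derive1 sigma (dotv w (rv_of_tuple x)) * dotv (w - wstar) (rv_of_tuple x).
have mg : measurable_fun setT g.
  apply: measurable_funM; last exact: measurable_dotv.
  exact: (measurableT_comp ms' (measurable_dotv w)).
have bs v : bounded_measurable (fun t => sigma (dotv v (rv_of_tuple (X t)))).
  split; first exact: (measurableT_comp ms (bounded_measurable_dotv v).1).
  by exists 1 => t; have /andP[? ?] := s01 (dotv v (rv_of_tuple (X t))); rewrite ger0_norm.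
have bg : bounded_measurable (g \o X).
  apply: bounded_measurableM; last exact: bounded_measurable_dotv.
  split; first exact: (measurableT_comp ms' (bounded_measurable_dotv w).1).
  by exists 1 => t.
pose h t := (sigma (dotv w (rv_of_tuple (X t))) -
  sigma (dotv wstar (rv_of_tuple (X t)))) * g (X t).
have bh : bounded_measurable h.
  apply: bounded_measurableM => //; apply: bounded_measurableD => //.
  exact: bounded_measurableN.
have bgE : bounded_measurable (fun t => g (X t) * Eps t) by exact: bounded_measurableM.
have -> : \int[P]_t score sigma wstar w (X t, Eps t) =
    \int[P]_t h t + -1 * \int[P]_t (g (X t) * Eps t).
  rewrite -meanZ// -meanD//; last first.
    by apply: bounded_measurableM => //; exact: bounded_measurable_cst.
  by apply: eq_Rintegral => t _; rewrite /score /h /g/=; ring.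
(* [g] depends on the point alone, so this mean factors and the centred noise annihilates it. *)
have -> : \int[P]_t (g (X t) * Eps t) = 0.
  have := mean_mul_independent P X Eps g idfun mX mE ind mg _ bg bE.
  by rewrite /= E0 mulr0; apply; exact: measurable_id.
rewrite mulr0 addr0.
have b2 : bounded_measurable (fun t => dotv (w - wstar) (rv_of_tuple (X t)) ^+ 2).
  by under eq_fun do rewrite expr2; apply: bounded_measurableM;
    exact: bounded_measurable_dotv.
have := ler_wpM2l (sqr_ge0 gam) (mean_dotv_sqr_ge (w - wstar)).
rewrite -norm2_sqr mulrA => /le_trans; apply.
rewrite -meanZ//; apply: mean_le => //.
  by apply: bounded_measurableM => //; exact: bounded_measurable_cst.
move=> t; rewrite /h /g; set x := rv_of_tuple (X t).
have vb v : norm2 v <= r -> `|dotv v x| <= B * r.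
  move=> vr; rewrite (le_trans (normr_dotv_le _ _))// mulrC ler_pM ?norm2_ge0//.
  exact: XB.
have k1 : gam <= derive1 sigma (dotv w x) by apply: sg; rewrite -ler_norml vb.
have k2 := derive1_ge_monotone sigma ds gam (B * r) _ _ sg (vb _ wsr) (vb _ wr).
rewrite dotvBl; set a := dotv w x in k1 k2 *; set b := dotv wstar x in k2 *.
rewrite [leLHS](_ : _ = gam * (gam * (a - b) ^+ 2)); last by ring.
rewrite [leRHS](_ : _ = derive1 sigma a * ((sigma a - sigma b) * (a - b))); last by ring.
have p0 : 0 <= gam * (a - b) ^+ 2 by apply: mulr_ge0; [exact: ltW|exact: sqr_ge0].
by apply: ler_pM => //; exact: ltW.
Qed.

End Population.

(** * Numerical estimates and the union bound *)

(** On an interval of length [2 * (B * r)] the function [sigma] climbs with slope at least [gam],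
    yet by at most 1 in total. *)
Lemma radius_bound {R : realType} (B r gam : R) (sigma : R -> R) :
  0 <= B * r -> (forall t : R, derivable sigma t 1) ->
  (forall t, 0 <= sigma t <= 1) ->
  (forall t, - (B * r) <= t <= B * r -> gam <= derive1 sigma t) ->
  0 < gam -> 2 * gam * (B * r) <= 1.
Proof.
move=> Br0 ds s01 sg g0.
have [->|Br] := eqVneq (B * r) 0; first by rewrite mulr0.
have Brp : 0 < B * r by rewrite lt_neqAle eq_sym Br.
have h := derive1_ge_monotone sigma ds gam (B * r) (- (B * r)) (B * r) sg.
have := h _ _; rewrite normrN ger0_norm// => /(_ (lexx _) (lexx _)).
rewrite opprK => k1.
have /andP[? ?] := s01 (B * r); have /andP[? ?] := s01 (- (B * r)).
have k2 : (sigma (B * r) - sigma (- (B * r))) * (B * r + B * r) <=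
    1 * (B * r + B * r).
  by rewrite ler_wpM2r ?addr_ge0//; lra.
by rewrite -(ler_pM2r (addr_gt0 Brp Brp)); lra.
Qed.

(** Since [5 <= expR 4], the number [4 n^2 + 1] of values per coordinate is at most
    [expR (2 * (2 + ln (n%:R * br)))]; this is where the 2 beside the logarithm comes from. The
    product is then at most [delta ^+ 2], hence at most [delta]. *)
Lemma grid_card_bound {R : realType} (d n : nat) (br Q delta : R) :
  (0 < n)%N -> 1 <= br -> 0 < delta < 1 ->
  n%:R * Q = d%:R * (2 + ln (n%:R * br)) + ln delta^-1 ->
  #|{ffun 'I_d -> 'I_(2 * (2 * n ^ 2)).+1}|%:R * expR (- (2 * n%:R * Q)) <= delta.
Proof.
move=> n0 br1 /andP[d0 d1] nQ.
have nR1 : 1 <= n%:R :> R by rewrite ler1n.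
have nbr1 : 1 <= n%:R * br by rewrite mulr_ege1.
have nbr0 : 0 < n%:R * br by rewrite (lt_le_trans _ nbr1).
rewrite card_ffun !card_ord natrX.
have e4 : 5 <= expR 4 :> R by have := expR_ge1Dx (4 : R); lra.
have h : (2 * (2 * n ^ 2)).+1%:R <= expR (2 * (2 + ln (n%:R * br))) :> R.
  have -> : 2 * (2 + ln (n%:R * br)) = 4 + 2 * ln (n%:R * br) by ring.
  rewrite expRD expRM_natl lnK ?posrE//.
  have k1 : (2 * (2 * n ^ 2)).+1%:R <= 5 * n%:R ^+ 2 :> R.
    rewrite -natr1 2!natrM natrX.
    by have := exprn_ege1 2 nR1; lra.
  apply: (le_trans k1); rewrite ler_pM ?sqr_ge0//.
  by rewrite ler_pXn2r ?nnegrE ?ler0n ?(ltW nbr0)// ler_peMr.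
have h2 : (2 * (2 * n ^ 2)).+1%:R ^+ d <=
    expR (2 * n%:R * Q - 2 * ln delta^-1) :> R.
  have -> : 2 * n%:R * Q - 2 * ln delta^-1 = d%:R * (2 * (2 + ln (n%:R * br))).
    by rewrite -mulrA nQ; ring.
  by rewrite expRM_natl; apply: lerXn2r; rewrite ?nnegrE ?expR_ge0.
apply: (le_trans (ler_wpM2r (expR_ge0 _) h2)).
rewrite -expRD addrAC subrr add0r -mulrN -lnV ?posrE ?invr_gt0// invrK.
rewrite expRM_natl lnK ?posrE// expr2 -[leRHS]mulr1.
by rewrite ler_wpM2l// ltW.
Qed.

(** With [c = B / kap] and [q = Num.sqrt Q], the inequality becomes [a^2 <= 8 c q a + (c q)^2],
    which forces [a <= 9 c q]; the rounding distance fits into one more [c q]. *)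
Lemma radius_from_quadratic {R : realType} (n : nat) (B r kap Q a : R) :
  (0 < n)%N -> 1 <= B * r -> 0 < B -> 0 < r -> 0 < kap -> 4 * r ^+ 2 * kap <= 1 ->
  n%:R^-1 <= Q <= 1 -> 0 <= a ->
  kap * a ^+ 2 <= 8 * B * a * Num.sqrt Q + 8 * B ^+ 2 * r * (r / (2 * n%:R)) ->
  a + r / (2 * n%:R) <= 10 * B / kap * Num.sqrt Q.
Proof.
move=> n0 Br1 B0 r0 k0 kr /andP[nQ Q1] a0.
have nR0 : 0 < n%:R :> R by rewrite ltr0n.
have Q0 : 0 < Q by rewrite (lt_le_trans _ nQ)// invr_gt0.
set q := Num.sqrt Q; have q0 : 0 < q by rewrite sqrtr_gt0.
have qQ : q ^+ 2 = Q by rewrite sqr_sqrtr// ltW.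
have q1 : q <= 1 by rewrite -sqrtr1 ler_sqrt.
have -> : r / (2 * n%:R) = r * n%:R^-1 / 2 by field; rewrite gt_eqF.
set p := n%:R^-1 in nQ *; have p0 : 0 < p by rewrite invr_gt0.
set c := B / kap.
have c0 : 0 < c by rewrite divr_gt0.
have Bc : B = kap * c by rewrite /c mulrC divfK// gt_eqF.
have rc : 4 * r <= c.
  rewrite /c ler_pdivlMr//; apply: (@le_trans _ _ (4 * r * kap * (B * r))).
    by rewrite ler_peMr// !mulr_ge0 ?ltW.
  have := ler_wpM2l (ltW B0) kr; lra.
(* The discretisation error is [4 B^2 r^2 / n]; use [4 r^2 <= 1 / kap] and [1 / n <= Q]. *)
have r2B : 8 * B ^+ 2 * r * (r * p / 2) <= kap * (c * q) ^+ 2.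
  have e1 : 8 * B ^+ 2 * r * (r * p / 2) = B ^+ 2 * (4 * r ^+ 2) * p by field.
  have e2 : kap * (c * q) ^+ 2 = B ^+ 2 / kap * Q.
    by rewrite exprMn qQ /c; field; rewrite gt_eqF.
  rewrite e1 e2; apply: ler_pM => //; [|exact: ltW|].
    by apply: mulr_ge0; [exact: sqr_ge0|rewrite mulr_ge0 ?sqr_ge0].
  by rewrite ler_wpM2l ?sqr_ge0// -[leRHS]mul1r ler_pdivlMr.
move=> /le_trans/(_ (lerD (lexx _) r2B)) H.
have a9 : a <= 9 * (c * q).
  have cq0 : 0 < c * q by rewrite mulr_gt0.
  have H2 : a ^+ 2 <= 8 * (c * q) * a + (c * q) ^+ 2.
    by rewrite -(ler_pM2l k0) (le_trans H)// le_eqVlt; apply/orP; left;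
      apply/eqP; rewrite Bc; ring.
  rewrite leNgt; apply/negP => a9.
  have k1 : 0 < (a - 9 * (c * q)) * a by rewrite mulr_gt0//; lra.
  have k2 : 0 < (a - 9 * (c * q)) * (c * q) by rewrite mulr_gt0//; lra.
  by have := sqr_ge0 (c * q); lra.
have -> : 10 * B / kap * q = 10 * (c * q) by rewrite /c; ring.
have k3 : r * p <= c * q.
  apply: ler_pM; [exact: ltW|exact: ltW|lra|].
  rewrite (le_trans nQ)// -qQ expr2 -[leRHS]mulr1.
  by rewrite ler_wpM2l// ltW.
have : 0 <= c * q by apply: mulr_ge0; exact: ltW.
lra.
Qed.

Lemma union_bound {R : realType} {dT} {T : measurableType dT} (P : probability T R)
    (K : finType) (bad : K -> set T) (p : R) :
  (forall k, measurable (bad k)) -> (forall k, (P (bad k) <= p%:E)%E) ->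
  measurable (\bigcup_k bad k) /\ (P (\bigcup_k bad k) <= (#|K|%:R * p)%:E)%E.
Proof.
move=> mbad Pbad.
have fK : finite_set [set: K] by exact: finite_finset.
have mU : measurable (\bigcup_k bad k).
  by apply: fin_bigcup_measurable => // k _; exact: mbad.
split => //.
have := content_sub_fsum P fK (fun k _ => mbad k) mU (@subset_refl _ _).
move=> /le_trans; apply; rewrite fsbig_finite//=.
rewrite (perm_big (enum K)) /=; last first.
  apply: uniq_perm; [exact: finmap.fset_uniq|exact: enum_uniq|move=> k].
  by rewrite mem_enum in_fset_set// in_setT.
rewrite (le_trans (lee_sum _ (fun k _ => Pbad k)))//.
by rewrite sumEFin big_enum/= sumr_const mulr_natl.
Qed.

(** * The estimate for samples bounded everywhere *)

Section BoundedSample.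
Context {R : realType} {dT : measure_display} {T : measurableType dT}
  (P : probability T R) {d n : nat} (B r lam gam : R) (sigma : R -> R)
  (wstar : 'rV[R]_d) (X : 'I_n -> T -> d.-tuple R) (Eps : 'I_n -> T -> R).

(** The theorem with sure instead of almost sure bounds, which makes every function involved
    [bounded_measurable]. *)
Lemma bounded_sample_bound (delta : R) :
  (0 < n)%N ->
  (forall i, measurable_fun setT (X i)) ->
  (forall i, measurable_fun setT (Eps i)) ->
  (forall A : 'I_n -> set (d.-tuple R * R), (forall i, measurable (A i)) ->
     P (\bigcap_(i in [set: 'I_n]) ((fun t => (X i t, Eps i t)) @^-1` A i)) =
     (\prod_(i < n) P ((fun t => (X i t, Eps i t)) @^-1` A i))%E) ->
  (forall i (A : set (d.-tuple R)) (E : set R), measurable A -> measurable E ->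
     P (X i @^-1` A `&` Eps i @^-1` E) =
     (P (X i @^-1` A) * P (Eps i @^-1` E))%E) ->
  (forall i t, norm2 (rv_of_tuple (X i t)) <= B) ->
  0 < lam -> (forall i, psd_lower_bound (second_moment P (X i)) lam) ->
  norm2 wstar <= r -> 1 <= B * r ->
  (forall t : R, derivable sigma t 1) ->
  (forall t : R, derivable (derive1 sigma) t 1) ->
  (forall t, 0 <= sigma t <= 1) ->
  (forall t, `|derive1 sigma t| <= 1) ->
  (forall t, `|derive1 (derive1 sigma) t| <= 1) ->
  0 < gam -> (forall t, - (B * r) <= t <= B * r -> gam <= derive1 sigma t) ->
  (forall i t, `|Eps i t| <= 1) -> (forall i, \int[P]_t Eps i t = 0) ->
  0 < delta < 1 ->
  exists E : set T, measurable E /\ ((1 - delta)%:E <= P E)%E /\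
    forall t, E t -> forall w : 'rV[R]_d, norm2 w <= r ->
      grad_zero (emp_risk sigma (fun i => rv_of_tuple (X i t))
        (fun i => sigma (dotv wstar (rv_of_tuple (X i t))) + Eps i t)) w ->
      norm2 (w - wstar) <= 10 * B / (gam ^+ 2 * lam) *
        Num.sqrt ((d%:R * (2 + ln (n%:R * B * r)) + ln delta^-1) / n%:R).
Proof.
move=> n0 mX mE ind indXE XB lam0 XP wsr Br1 ds ds' s01 ds1 ds2 gam0 sg E1 E0 d01.
have /andP[delta0 delta1] := d01.
have r0 : 0 < r.
  rewrite lt_neqAle (le_trans (norm2_ge0 _) wsr) andbT; apply/eqP => r0.
  by move: Br1; rewrite -r0 mulr0 ler10.
have B0 : 0 < B by rewrite -(pmulr_lgt0 _ r0) (lt_le_trans _ Br1).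
set Q := (X in Num.sqrt X); set kap := gam ^+ 2 * lam.
have kap0 : 0 < kap by rewrite mulr_gt0// exprn_gt0.
have nR0 : 0 < n%:R :> R by rewrite ltr0n.
have nR1 : 1 <= n%:R :> R by rewrite ler1n.
have nQ : n%:R * Q = d%:R * (2 + ln (n%:R * (B * r))) + ln delta^-1.
  by rewrite /Q mulrC divfK ?gt_eqF// mulrA.
have ln1 : 0 <= ln (n%:R * (B * r)) by rewrite ln_ge0// mulr_ege1.
have ln2 : 0 <= ln delta^-1 by rewrite ln_ge0// invf_ge1// ltW.
have PT : ((1 - delta)%:E <= P setT)%E.
  by rewrite probability_setT lee_fin gerBl ltW.
(* In dimension 0 all vectors coincide; afterwards [d] is positive, as the comparison of [lam] with
   [B ^+ 2] requires. *)
have [d0|d0] := posnP d.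
  exists setT; split => //; split => // t _ w _ _.
  have -> : norm2 (w - wstar) = 0.
    apply/eqP; rewrite eq_le norm2_ge0 andbT.
    rewrite (le_trans (norm2_le_const _ 0 _ _)) ?mulr0// => j.
    by have := ltn_ord j; rewrite {2}d0.
  by rewrite mulr_ge0 ?sqrtr_ge0// divr_ge0 ?mulr_ge0 ?ltW.
have dR1 : 1 <= d%:R :> R by rewrite ler1n.
(* Replace [lam] by [B ^+ 2] and recognise the square of [2 * gam * (B * r)]. *)
have kr : 4 * r ^+ 2 * kap <= 1.
  have h := second_moment_bound P (X (Ordinal n0)) B lam (mX _) (XB _) (XP _) d0.
  have g := radius_bound B r gam sigma (le_trans ler01 Br1) ds s01 sg gam0.
  have g2 : (2 * gam * (B * r)) ^+ 2 <= 1.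
    by rewrite expr_le1// mulr_ge0 ?(le_trans ler01 Br1)// mulr_ge0// ltW.
  apply: le_trans g2.
  have := ler_wpM2l (mulr_ge0 (sqr_ge0 (2 * r)) (sqr_ge0 gam)) h.
  by rewrite /kap; lra.
(* For [Q > 1] the diameter [2 r] of the ball is already below the claimed radius. *)
have [Q1|Q1] := ltP 1 Q.
  exists setT; split => //; split => // t _ w wr _.
  have q1 : 1 <= Num.sqrt Q by rewrite -sqrtr1 ler_sqrt ltW// (lt_trans _ Q1).
  apply: (@le_trans _ _ (r + r)).
    by rewrite (le_trans (norm2D _ _))// norm2N lerD.
  apply: (@le_trans _ _ (10 * B / kap)); last first.
    by rewrite ler_peMr// divr_ge0 ?mulr_ge0 ?ltW.
  have rk0 : 0 <= 2 * r * kap by rewrite !mulr_ge0// ltW.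
  rewrite ler_pdivlMr//; apply: (@le_trans _ _ (2 * r * kap * (B * r))).
    by have := ler_wpM2l rk0 Br1; lra.
  by have := ler_wpM2l (ltW B0) kr; lra.
have Q0 : 0 < Q.
  rewrite -(pmulr_rgt0 _ nR0) nQ.
  by have := ler_wpM2l (ler0n R d) ln1; lra.
have nQ1 : n%:R^-1 <= Q.
  rewrite -(ler_pM2l nR0) nQ divff ?gt_eqF//.
  by have := ler_wpM2l (ler0n R d) ln1; lra.
pose q := Num.sqrt Q.
have qQ : q ^+ 2 = Q by rewrite sqr_sqrtr// ltW.
have q01 : 0 <= q <= 1 by rewrite sqrtr_ge0 -sqrtr1 ler_sqrt.
(* The mesh is [r / (2 n^2)], so that even after a loss of [Num.sqrt d%:R <= n%:R] the rounding
   distance is at most [r / (2 n)]. *)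
pose M := (2 * n ^ 2)%N.
pose s := r / M%:R.
have MR : M%:R = 2 * n%:R ^+ 2 :> R by rewrite natrM natrX.
have M0 : 0 < M%:R :> R by rewrite MR mulr_gt0// exprn_gt0.
have s0 : 0 < s by rewrite divr_gt0.
pose wk (k : {ffun 'I_d -> 'I_(2 * M).+1}) : 'rV[R]_d := grid_point s k.
(* [a k] is the sure bound on the score at [wk k]. If [wk k = wstar] it is 0, and so is its inverse
   by convention; [f k] and [m k] then vanish and the tail bound still applies. *)
pose a k := 2 * B * norm2 (wk k - wstar).
pose f k z := (a k)^-1 * score sigma wstar (wk k) z.
pose m k := (a k)^-1 * (kap * norm2 (wk k - wstar) ^+ 2).
pose F k t := \sum_(i < n) f k (X i t, Eps i t).
(* The grid fills a cube; its points outside the ball get the empty event, because the lower bound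
   on the mean score is available only inside the ball. *)
pose bad k := if norm2 (wk k) <= r then [set t | F k t <= n%:R * (m k - 4 * q)]
              else set0.
have a0 k : 0 <= a k by rewrite !mulr_ge0 ?norm2_ge0// ltW.
have mf k : measurable_fun setT (f k).
  by apply: measurable_funM => //; exact: measurable_score.
have mZ i : measurable_fun setT (fun t => (X i t, Eps i t)).
  exact: measurable_fun_pair.
have mbad k : measurable (bad k).
  rewrite /bad; case: ifP => // _.
  have mF : measurable_fun setT (F k).
    by apply: measurable_sum => i; exact: (measurableT_comp (mf k) (mZ i)).
  rewrite [X in measurable X](_ : _ = setT `&` F k @^-1`
      `]-oo, n%:R * (m k - 4 * q)]%classic); first exact: mF.
  by apply/seteqP; split=> t; rewrite /= in_itv/=; [|case].
have sb k i t : `|score sigma wstar (wk k) (X i t, Eps i t)| <= a k.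
  exact: (score_bound sigma wstar B s01 ds1 (wk k) (X i t, Eps i t) (XB i t) (E1 i t)).
have Pbad k : (P (bad k) <= (expR (- (2 * n%:R * Q)))%:E)%E.
  rewrite /bad; case: ifP => [wkr|_]; last by rewrite measure0 lee_fin expR_ge0.
  rewrite -qQ; apply: (hoeffding_lower_tail P n (fun i t => (X i t, Eps i t))) => //.
    move=> i t; rewrite /f normrM ger0_norm ?invr_ge0//.
    have [ak|ak] := eqVneq (a k) 0; first by rewrite ak invr0 mul0r.
    rewrite mulrC ler_pdivrMr ?mul1r ?sb//.
    by rewrite lt_neqAle eq_sym ak a0.
  move=> i; rewrite meanZ; last first.
    split.
      exact: (measurableT_comp (measurable_score _ _ (wk k) ds ds') (mZ i)).
    by exists (a k) => t; exact: sb.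
  rewrite ler_wpM2l ?invr_ge0//.
  exact: (mean_score_ge P (X i) B lam (mX i) (XB i) (XP i) (Eps i) sigma
    wstar (wk k) r gam (mE i) (E1 i) (E0 i) (indXE i) ds ds' s01 ds1 gam0 sg wsr wkr).
have [mU PU] := union_bound P _ bad _ mbad Pbad.
exists (~` \bigcup_k bad k); split; first exact: measurableC.
split.
  rewrite probability_setC// EFinB leeB// (le_trans PU)// lee_fin.
  exact: (grid_card_bound d n (B * r)).
move=> t Et w wr gw.
have rsM : r <= s * M%:R by rewrite /s divfK// gt_eqF.
have [k [wkw wwk]] := grid_net d M s r w s0 rsM wr.
have dn : Num.sqrt d%:R * s <= r / (2 * n%:R).
  have d_n : d%:R <= n%:R :> R.
    have : n%:R * Q <= n%:R by rewrite ler_piMr.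
    by rewrite nQ; have := ler_wpM2l (ler0n R d) ln1; lra.
  have sd : Num.sqrt d%:R <= n%:R :> R.
    rewrite (le_trans _ d_n)// -[leRHS]ger0_norm// -sqrtr_sqr ler_sqrt ?sqr_ge0//.
    by rewrite expr2 ler_peMr.
  rewrite (le_trans (ler_wpM2r (ltW s0) sd))// le_eqVlt; apply/orP; left; apply/eqP.
  by rewrite /s MR; field; rewrite gt_eqF.
have wk_near : norm2 (w - wk k) <= r / (2 * n%:R) by exact: le_trans dn.
have wkr : norm2 (wk k) <= r by exact: le_trans wr.
set eta := r / (2 * n%:R) in wk_near *.
have eta0 : 0 <= eta by rewrite (le_trans _ wk_near) ?norm2_ge0.
pose u := norm2 (wk k - wstar).
apply: (@le_trans _ _ (u + eta)).
  have -> : w - wstar = (wk k - wstar) + (w - wk k) by rewrite [RHS]addrC addrA subrK.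
  by rewrite (le_trans (norm2D _ _))// lerD2l.
apply: (radius_from_quadratic n B r kap Q u) => //; rewrite ?nQ1 ?norm2_ge0//.
(* At [u = 0] the normalisation degenerates, but the quadratic inequality has left side 0. *)
have [u0|u0] := eqVneq u 0.
  rewrite u0 expr0n/= !mulr0 mul0r add0r.
  by rewrite mulr_ge0// !mulr_ge0 ?sqr_ge0// ltW.
have up : 0 < u by rewrite lt_neqAle eq_sym u0 norm2_ge0.
have ap : 0 < a k by rewrite /a -/u !mulr_gt0.
have good : n%:R * (m k - 4 * q) < F k t.
  rewrite ltNge; apply/negP => Fk; apply: Et; exists k => //.
  by rewrite /bad wkr.
have FE : a k * F k t = \sum_(i < n) score sigma wstar (wk k) (X i t, Eps i t).
  rewrite mulr_sumr; apply: eq_bigr => i _.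
  by rewrite /f mulrA divff ?mul1r// gt_eqF.
(* The scores at [w] sum to 0, so the sum at [wk k] consists of Lipschitz errors only. *)
have near_score : \sum_(i < n) score sigma wstar (wk k) (X i t, Eps i t) <=
    n%:R * (8 * B ^+ 2 * r * eta).
  have sw := sum_score_grad_zero sigma wstar ds n (X ^~ t) (Eps ^~ t) w n0 gw.
  rewrite -[leLHS]subr0 -[X in _ - X]sw -sumrB mulr_natl -[X in _ *+ X]card_ord -sumr_const.
  apply: ler_sum => i _; rewrite (le_trans (ler_norm _))// distrC.
  exact: (score_lipschitz sigma wstar B s01 ds ds1 r eta w (wk k) (X i t, Eps i t)
    ds' ds2 Br1 wsr wr wk_near (XB i t) (E1 i t)).
rewrite -/q -/eta; move: good.
rewrite -(ltr_pM2l ap) FE => /lt_le_trans/(_ near_score)/ltW.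
(* Undoing the normalisation turns the deviation [4 * q] into [8 * B * u * q], the linear term of
   the quadratic inequality. *)
have -> : a k * (n%:R * (m k - 4 * q)) =
    n%:R * (kap * u ^+ 2 - 8 * B * u * q).
  by rewrite /m -/u /a -/u; field; rewrite u0 gt_eqF.
rewrite ler_pM2l// => h; lra.
Qed.

End BoundedSample.

(** * Truncation to a bounded sample *)

(* Replacing the sample by its truncation changes it only on a null set and
   makes the almost sure bounds of the hypotheses hold everywhere. *)
Definition truncate_point {R : realType} {d : nat} (B : R) (x : d.-tuple R) : d.-tuple R :=
  if dotv (rv_of_tuple x) (rv_of_tuple x) <= B ^+ 2 then x else nseq_tuple d 0.

Definition truncate_noise {R : realType} (e : R) : R := if `|e| <= 1 then e else 0.

Section Truncation.
Context {R : realType} {d : nat}.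

Lemma measurable_truncate_point (B : R) :
  measurable_fun setT (@truncate_point R d B).
Proof.
apply: measurable_fun_ifT => //; apply: measurable_fun_ler => //=.
exact: measurable_dotvv.
Qed.

Lemma norm2_truncate_point (B : R) (x : d.-tuple R) : 0 <= B ->
  norm2 (rv_of_tuple (truncate_point B x)) <= B.
Proof.
move=> B0; rewrite /truncate_point; case: ifP => [xB|_].
  by rewrite -(ler_pXn2r (n:=2)) ?nnegrE ?norm2_ge0// norm2_sqr.
suff -> : rv_of_tuple (nseq_tuple d 0) = 0 :> 'rV[R]_d by rewrite norm20.
by apply/rowP => j; rewrite !mxE (tnth_nth 0)/= nth_nseq if_same.
Qed.

Lemma truncate_point_id (B : R) (x : d.-tuple R) :
  norm2 (rv_of_tuple x) <= B -> truncate_point B x = x.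
Proof.
move=> xB; rewrite /truncate_point -norm2_sqr ler_pXn2r ?nnegrE ?norm2_ge0 ?xB//.
by rewrite (le_trans (norm2_ge0 _) xB).
Qed.

Lemma measurable_truncate_noise : measurable_fun setT (@truncate_noise R).
Proof.
apply: measurable_fun_ifT => //; apply: measurable_fun_ler => //=.
Qed.

Lemma truncate_noise_le1 (e : R) : `|truncate_noise e| <= 1.
Proof. by rewrite /truncate_noise; case: ifP => //; rewrite normr0. Qed.

Lemma truncate_noise_id (e : R) : `|e| <= 1 -> truncate_noise e = e.
Proof. by rewrite /truncate_noise => ->. Qed.

End Truncation.

Lemma second_moment_ae {R : realType} {dT} {T : measurableType dT}
    (P : probability T R) (d : nat) (X Y : T -> d.-tuple R) :
  measurable_fun setT X -> measurable_fun setT Y ->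
  {ae P, forall t, Y t = X t} -> second_moment P Y = second_moment P X.
Proof.
move=> mX mY XY; apply/matrixP => j k; rewrite !mxE unlock; congr fine.
have mt (Z : T -> d.-tuple R) (mZ : measurable_fun setT Z) :
    measurable_fun setT (fun t => (tnth (Z t) j * tnth (Z t) k)%:E).
  apply/measurable_EFinP; apply: measurable_funM;
  exact: (measurableT_comp (measurable_tnth _) mZ).
apply: ae_eq_integral => //; [exact: mt|exact: mt|].
by apply: filterS XY => t -> _.
Qed.

Theorem theorem3p2 (R : realType) :
  exists C1 C2 : R, 0 < C1 /\ 0 < C2 /\
  forall (dT : measure_display) (T : measurableType dT) (P : probability T R)
    (d n : nat) (B Rw lam gam : R) (sigma : R -> R) (wstar : 'rV[R]_d)
    (X : 'I_n -> T -> d.-tuple R) (Eps : 'I_n -> T -> R),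
    (* sample size *)
    (0 < n)%N ->
    (* measurability of the sample *)
    (forall i, measurable_fun setT (X i)) ->
    (forall i, measurable_fun setT (Eps i)) ->
    (* the pairs (x_i, eps_i) are mutually independent *)
    (forall A : 'I_n -> set (d.-tuple R * R),
        (forall i, measurable (A i)) ->
        P (\bigcap_(i in [set: 'I_n]) ((fun t => (X i t, Eps i t)) @^-1` A i))
        = (\prod_(i < n) P ((fun t => (X i t, Eps i t)) @^-1` A i))%E) ->
    (* ... and identically distributed *)
    (forall (i j : 'I_n) (A : set (d.-tuple R * R)), measurable A ->
        P ((fun t => (X i t, Eps i t)) @^-1` A)
        = P ((fun t => (X j t, Eps j t)) @^-1` A)) ->
    (* the noise is independent of x *)
    (forall (i : 'I_n) (A : set (d.-tuple R)) (E : set R),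
        measurable A -> measurable E ->
        P (X i @^-1` A `&` Eps i @^-1` E)
        = (P (X i @^-1` A) * P (Eps i @^-1` E))%E) ->
    (* Assumption (1) *)
    (forall i, {ae P, forall t, norm2 (rv_of_tuple (X i t)) <= B}) ->
    0 < lam ->
    (forall i, psd_lower_bound (second_moment P (X i)) lam) ->
    (* Assumption (2) *)
    norm2 wstar <= Rw -> 1 <= B * Rw ->
    (* Assumption (3) *)
    {mono sigma : s t / s < t} ->
    (forall t, derivable sigma t 1) ->
    (forall t, derivable ((derive1 sigma)) t 1) ->
    (forall t, 0 <= sigma t <= 1) ->
    (forall t, `|(derive1 sigma) t| <= 1 /\ `|(derive1 (derive1 sigma)) t| <= 1) ->
    0 < gam ->
    (forall t, - (B * Rw) <= t <= B * Rw -> gam <= (derive1 sigma) t) ->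
    (* Assumption (4) and mean-zero noise *)
    (forall i, {ae P, forall t, `|Eps i t| <= 1}) ->
    (forall i, ('E_P[Eps i] = 0)%E) ->
    forall delta : R, 0 < delta < 1 ->
    exists E : set T, measurable E /\ ((1 - delta)%:E <= P E)%E /\
      forall t, E t ->
      forall w : 'rV[R]_d,
        norm2 w <= Rw ->
        grad_zero
          (emp_risk sigma (fun i => rv_of_tuple (X i t))
             (fun i => sigma (dotv wstar (rv_of_tuple (X i t))) + Eps i t)) w ->
        norm2 (w - wstar) <=
          C1 * B / (gam ^+ 2 * lam) *
          Num.sqrt ((d%:R * (C2 + ln (n%:R * B * Rw)) + ln delta^-1) / n%:R).
Proof.
(* The 10 comes from [radius_from_quadratic], the 2 from [grid_card_bound]. *)
exists 10, 2; do 2 split => //.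
move=> dT T P d n B Rw lam gam sigma wstar X Eps n0 mX mE ind _ indXE XB lam0 XP
  wsr BR1 _ ds ds' s01 ds12 gam0 sg E1 E0 delta d01.
have B0 : 0 <= B.
  have Rw0 : 0 <= Rw by rewrite (le_trans (norm2_ge0 _) wsr).
  by rewrite leNgt; apply/negP => B0; have := mulr_le0_ge0 (ltW B0) Rw0; lra.
pose X' i t := truncate_point B (X i t).
pose Eps' i t := truncate_noise (Eps i t).
have mtp := measurable_truncate_point (d := d) B.
have mtn := measurable_truncate_noise (R := R).
have mX' i : measurable_fun setT (X' i) by exact: measurableT_comp.
have mE' i : measurable_fun setT (Eps' i) by exact: measurableT_comp.
have mt : measurable_fun setT
    (fun z : d.-tuple R * R => (truncate_point B z.1, truncate_noise z.2)).
  by apply: measurable_fun_pair; exact: measurableT_comp.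
have XX' i : {ae P, forall t, X' i t = X i t}.
  by apply: filterS (XB i) => t /truncate_point_id.
have EE' i : {ae P, forall t, Eps' i t = Eps i t}.
  by apply: filterS (E1 i) => t /truncate_noise_id.
have E0' i : \int[P]_t Eps' i t = 0.
  have := E0 i; rewrite unlock /Rintegral => Ei.
  rewrite (ae_eq_integral (EFin \o Eps i)) ?Ei//; try exact/measurable_EFinP.
  by apply: filterS (EE' i) => t /= -> _.
(* Truncation is a measurable map applied to each pair separately, so independence is inherited
   through preimages. *)
have ind' (A : 'I_n -> set (d.-tuple R * R)) : (forall i, measurable (A i)) ->
    P (\bigcap_(i in [set: 'I_n]) ((fun t => (X' i t, Eps' i t)) @^-1` A i)) =
    (\prod_(i < n) P ((fun t => (X' i t, Eps' i t)) @^-1` A i))%E.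
  move=> mA; apply: (ind (fun i => (fun z => (truncate_point B z.1, truncate_noise z.2))
    @^-1` A i)) => i.
  by rewrite -[X in measurable X]setTI; exact: mt.
have indXE' i (A : set (d.-tuple R)) (D : set R) : measurable A -> measurable D ->
    P (X' i @^-1` A `&` Eps' i @^-1` D) =
    (P (X' i @^-1` A) * P (Eps' i @^-1` D))%E.
  move=> mA mD; apply: (indXE i (truncate_point B @^-1` A) (truncate_noise @^-1` D)).
    by rewrite -[X in measurable X]setTI; exact: mtp.
  by rewrite -[X in measurable X]setTI; exact: mtn.
have XP' i : psd_lower_bound (second_moment P (X' i)) lam.
  by rewrite (second_moment_ae P d (X i)).
have [E [mEv [PE Egood]]] := bounded_sample_bound P B Rw lam gam sigma wstar X' Eps'
  delta n0 mX' mE' ind' indXE' (fun i t => norm2_truncate_point B (X i t) B0) lam0 XP'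
  wsr BR1 ds ds' s01 (fun t => (ds12 t).1) (fun t => (ds12 t).2) gam0 sg
  (fun i t => truncate_noise_le1 (Eps i t)) E0' d01.
(* The index set is finite, so a single null set [N] covers all exceptional outcomes. *)
have : {ae P, forall t, forall i, X' i t = X i t /\ Eps' i t = Eps i t}.
  by apply: filter_forall => i; apply: filterS2 (XX' i) (EE' i) => t xx ee; split.
move=> [N [mN PN subN]].
(* Removing [N] leaves the probability unchanged and makes the truncated and the original sample
   agree. *)
exists (E `\` N); split; first exact: measurableD.
split => [|t [Et Nt] w wR gw].
  have <- : P E = P (E `\` N); last exact: PE.
  rewrite (measureDI P mEv mN) [X in (_ + X)%E](_ : _ = 0%E) ?adde0//.
  apply/eqP; rewrite -measure_le0 -PN.
  by apply: le_measure; rewrite ?inE//; exact: measurableI.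
have good : forall i, X' i t = X i t /\ Eps' i t = Eps i t.
  by apply: contrapT => h; apply: Nt; exact: subN.
apply: (Egood t Et w wR); move: gw.
have -> : (fun i => rv_of_tuple (X' i t)) = (fun i => rv_of_tuple (X i t)).
  by apply/funext => i; rewrite (good i).1.
suff -> : (fun i => sigma (dotv wstar (rv_of_tuple (X' i t))) + Eps' i t) =
  (fun i => sigma (dotv wstar (rv_of_tuple (X i t))) + Eps i t) by [].
by apply/funext => i; rewrite (good i).1 (good i).2.
Qed.
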